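(* Let $(X,d,\mu)$ be an irreversible metric measure space. Then $(X,d,\mu)$ has normal concentration, i.e. there are positive constants $C$ and $c$ such that $\alpha_{(X,d,\mu)}(r)\le C e^{-cr^2}$ for every $r>0$, if and only if there are positive constants $C'$ and $c'$ such that for every 1-Lipschitz function $f$ on $(X,d,\mu)$ and every $r>0$, $$\mu\left(\left\{x\in X \;\middle|\; \left|f(x)-\int_X f\,d\mu\right|\ge r\right\}\right)\le C' e^{-c' r^2}.$$ Here $C'=C'(C)$ and $c'=c'(c)$ are constants ($C'$ depending on $C$, and $c'$ depending on $c$).
   Context: An irreversible metric space $(X,d)$ is a set $X$ with a function $d:X\times X\to[0,\infty)$ such that $d(x_1,x_2)=0$ if and only if $x_1=x_2$, and $d(x_1,x_3)\le d(x_1,x_2)+d(x_2,x_3)$ for all $x_1,x_2,x_3\in X$ ($d$ need not be symmetric). An irreversible metric measure space $(X,d,\mu)$ is an irreversible metric space endowed with a Borel probability measure $\mu$. For $A\subset X$ and $r>0$ put $B^{+}(A,r)=\{x\in X\mid \inf_{z\in A}d(z,x)<r\}$ and $B^{-}(A,r)=\{x\in X\mid \inf_{z\in A}d(x,z)<r\}$. The concentration function is $$\alpha_{(X,d,\mu)}(r)=\sup\left\{1-\min\{\mu(B^{+}(A,r)),\mu(B^{-}(A,r))\}\;\middle|\; A\subset X \text{ Borel},\ \mu(A)\ge \tfrac12\right\},\quad r>0.$$ A function $f:X\to\mathbb{R}$ is $L$-Lipschitz ($L>0$) if $f(z)-f(x)\le L\,d(x,z)$ for all $x,z\in X$. The sets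 $B^{\pm}(A,r)$ and Lipschitz functions are understood to be measurable, so that the expressions above make sense. *)

(* Defs.v *)
From HB Require Import structures.
From mathcomp Require Import all_boot all_order all_algebra.
From mathcomp Require Import all_classical all_reals all_analysis.

Set Implicit Arguments.
Unset Strict Implicit.
Unset Printing Implicit Defensive.

Import Order.TTheory GRing.Theory Num.Theory.
Import numFieldNormedType.Exports.

Local Open Scope classical_set_scope.
Local Open Scope ring_scope.
Local Open Scope ereal_scope.

Notation borelType X := (g_sigma_algebraType (@open X)).

Definition irreversible_metric (R : realType) (X : Type) (d : X -> X -> R) :=
  [/\ forall x y : X, (0 <= d x y)%R,
      forall x y : X, d x y = 0%R <-> x = y &
      forall x y z : X, (d x z <= d x y + d y z)%R].

(* Infima are taken in \bar R, so that both neighborhoods of set0 are empty. *)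
Definition fwd_nbhd (R : realType) (X : Type) (d : X -> X -> R)
    (A : set X) (r : R) : set X :=
  [set x | ereal_inf [set (d z x)%:E | z in A] < r%:E].

Definition bwd_nbhd (R : realType) (X : Type) (d : X -> X -> R)
    (A : set X) (r : R) : set X :=
  [set x | ereal_inf [set (d x z)%:E | z in A] < r%:E].

Definition irr_lipschitz (R : realType) (X : Type) (d : X -> X -> R)
    (L : R) (f : X -> R) :=
  forall x z : X, (f z - f x <= L * d x z)%R.

(* The standing measurability convention. It is the only link between the
   topology of X and d: since y |-> d x y and y |-> - d y x are 1-Lipschitz for
   every x, it makes all forward and backward balls Borel. It holds automatically when X carries the
   topology generated by the forward balls, by the backward balls, or by
   both. *)
Definition borel_compatible (R : realType) (X : ptopologicalType)
    (d : X -> X -> R) :=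
  (forall (A : set (borelType X)) (r : R), measurable A -> (0 < r)%R ->
     measurable (fwd_nbhd d A r : set (borelType X)) /\
     measurable (bwd_nbhd d A r : set (borelType X))) /\
  (forall (L : R) (f : borelType X -> R), (0 < L)%R -> irr_lipschitz d L f ->
     measurable_fun [set: borelType X] f).

Definition concentration_function (R : realType) (X : ptopologicalType)
    (d : X -> X -> R) (mu : probability (borelType X) R) (r : R) : \bar R :=
  ereal_sup [set 1 - Order.min (mu (fwd_nbhd d A r)) (mu (bwd_nbhd d A r))
            | A in [set A : set (borelType X) |
                     measurable A /\ (2^-1)%:E <= mu A]].

Definition concentration_bound (R : realType) (X : ptopologicalType)
    (d : X -> X -> R) (mu : probability (borelType X) R) (C c : R) :=
  forall r : R, (0 < r)%R ->
    concentration_function d mu r <= (C * expR (- c * r ^+ 2))%:E.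

Definition normal_concentration (R : realType) (X : ptopologicalType)
    (d : X -> X -> R) (mu : probability (borelType X) R) :=
  exists C c : R, [/\ (0 < C)%R, (0 < c)%R & concentration_bound d mu C c].

(* The mean is the \bar R-valued integral. If f is measurable but not
   integrable, then the integral is infinite, the set below is the whole space
   for every r, and the inequality fails for large r; so the bound includes the
   integrability of f. *)
Definition deviation_bound (R : realType) (X : ptopologicalType)
    (d : X -> X -> R) (mu : probability (borelType X) R) (C c : R) :=
  forall f : X -> R, irr_lipschitz d 1%R f ->
  forall r : R, (0 < r)%R ->
    mu [set x | r%:E <= `|(f x)%:E - \int[mu]_y (f y)%:E|]
      <= (C * expR (- c * r ^+ 2))%:E.

(* Main.v *)
Require Import Defs.
From HB Require Import structures.
From mathcomp Require Import all_boot all_order all_algebra.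
From mathcomp Require Import all_classical all_reals all_analysis.
From mathcomp Require Import measurable_realfun ring lra.

Set Implicit Arguments.
Unset Strict Implicit.
Unset Printing Implicit Defensive.

Import Order.TTheory GRing.Theory Num.Theory.
Import numFieldNormedType.Exports.

Local Open Scope classical_set_scope.
Local Open Scope ring_scope.

(** Concentration of sets gives a Gaussian tail around a median [m] of a
    1-Lipschitz [f], since the forward neighborhood of [{f <= m}] lies in
    [{f < m + r}] and the backward neighborhood of [{f >= m}] in [{f > m - r}].
    The tail puts the mean within [a = (1 + 2 C) / sqrt c] of [m]; for
    [r >= 2 a] the tail at [r / 2] is used, and for [r < 2 a] the factor
    [exp ((1 + 2 C)^2) = exp (c / 4 * (2 a)^2)] makes the bound trivial.
    Conversely, apply the deviation bound to the distance from [A] and to minus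
    the distance to [A]: each vanishes on [A], which has measure at least
    [1 / 2], and so has a small mean. *)

(** * Superlevel sets, a geometric bound and medians *)

Lemma measurable_superlevel d (T : measurableType d) (R : realType)
    (h : T -> R) (t : R) :
  measurable_fun setT h -> measurable [set x | t <= h x].
Proof.
move=> mh; rewrite (_ : [set _ | _] = h @^-1` `[t, +oo[).
  by rewrite -[X in measurable X]setTI; exact: mh.
by apply/seteqP; split => x /=; rewrite in_itv/= andbT.
Qed.

(** Follows from [n <= n ^ 2] and [2 <= e]; it replaces a Gaussian series by a geometric one with an
    explicit sum. *)
Lemma expRN_le_half_exp (R : realType) (n : nat) :
  expR (- n%:R ^+ 2) <= 2^-1 ^+ n :> R.
Proof.
have h1 : 2 <= expR 1 :> R by have := @expR_ge1Dx R 1; rewrite -natr1 mulr1n.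
apply: (@le_trans _ _ (expR (- n%:R))).
  by rewrite ler_expR lerN2 -natrX ler_nat; case: n => // n; rewrite leq_pmulr.
rewrite expRN -[n%:R]mulr1 expRM_natl exprVn.
by rewrite lef_pV2 ?posrE ?exprn_gt0 ?expR_gt0// lerXn2r// ?nnegrE ?expR_ge0.
Qed.

(** The median is the infimum of the points where the cdf has reached 1/2. Right continuity of the
    cdf gives the first inequality, continuity of [P] along increasing unions the second. *)
Lemma median_exists d (T : measurableType d) (R : realType) (P : probability T R)
    (f : {RV P >-> R}) :
  exists m : R, ((2^-1)%:E <= P (f @^-1` `]-oo, m]))%E /\
                ((2^-1)%:E <= P (f @^-1` `[m, +oo[))%E.
Proof.
pose S := [set r | ((2^-1)%:E <= cdf f r)%E].
have S0 : S !=set0.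
  apply/set0P/negP => /eqP S_empty.
  have : (1 <= (2^-1)%:E :> \bar R)%E.
    apply: (cvge_to_le (@cvg_cdfy1 _ _ _ _ f)); apply: nearW => r.
    by rewrite leNgt; apply/negP => /ltW h; have : S r by []; rewrite S_empty.
  by rewrite lee_fin; lra.
(* Any [r] whose cdf is below 1/2 bounds [S] from below by monotonicity; without such an [r] the
   limit 0 at minus infinity would be at least 1/2. *)
have lS : has_lbound S.
  apply: contrapT => nS; have : ((2^-1)%:E <= 0 :> \bar R)%E.
    apply: (cvge_to_ge (@cvg_cdfNy0 _ _ _ _ f)); apply: nearW => r.
    rewrite leNgt; apply/negP => h; apply: nS; exists r => t St.
    rewrite leNgt; apply/negP => /ltW /(cdf_nondecreasing f) tr.
    by have := lt_le_trans (le_lt_trans tr h) St; rewrite ltxx.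
  by rewrite lee_fin; lra.
exists (inf S); split.
  apply: (cvge_to_ge (@cdf_right_continuous _ _ _ _ f (inf S))).
  near=> r.
  have /(inf_lt S0) [s Ss sr] : inf S < r by near: r; exact: nbhs_right_gt.
  by apply: (le_trans Ss); apply: cdf_nondecreasing; exact: ltW.
(* The sets [F n] increase to [{f < inf S}], and each has measure below 1/2 because
   [inf S - 1 / (n + 1)] lies outside [S]. *)
pose F n := f @^-1` `]-oo, (inf S - n.+1%:R^-1)%R].
have FE : f @^-1` `[inf S, +oo[ = ~` \bigcup_n F n.
  apply/seteqP; split => x /=.
    rewrite in_itv/= andbT => mx [n _]; rewrite /F/= in_itv/= leNgt => /negP; apply.
    by rewrite (lt_le_trans _ mx)// ltrBlDr ltrDl.
  rewrite in_itv/= andbT leNgt => h; apply/negP => xm; apply: h.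
  have e0 : 0 < inf S - f x by rewrite subr_gt0.
  exists (Num.bound (inf S - f x)^-1) => //; rewrite /F/= in_itv/=.
  rewrite lerBrDr -lerBrDl -[leRHS]invrK lef_pV2 ?posrE ?invr_gt0//.
  apply: ltW; apply: (lt_le_trans (archi_boundP _)); first by rewrite invr_ge0 ltW.
  by rewrite ler_nat.
have mF n : measurable (F n) by exact: measurable_funPTI.
have mU : measurable (\bigcup_n F n) by exact: bigcupT_measurable.
rewrite FE probability_setC//.
have : (P (\bigcup_n F n) <= (2^-1)%:E)%E.
  have ndF : nondecreasing_seq F.
    move=> m n mn; apply/subsetPset; apply: preimage_subset; apply: subset_itvl.
    by rewrite bnd_simp lerD2l lerN2 lef_pV2 ?posrE// ler_nat.
  apply: (cvge_to_le (nondecreasing_cvg_mu mF mU ndF)).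
  apply: nearW => n /=; rewrite leNgt; apply/negP => /ltW h.
  have := ge_inf lS (h : S _); rewrite leNgt => /negP; apply.
  by rewrite ltrBlDr ltrDl.
have : P (\bigcup_n F n) \is a fin_num by exact: fin_num_measure.
by case: (P _) => // p _; rewrite lee_fin => p2; rewrite lee_fin; lra.
Unshelve. all: by end_near. Qed.

(** * From Gaussian tails around a point to deviation from the mean, and back *)

Lemma expectation_gaussian_tail d (T : measurableType d) (R : realType)
    (P : probability T R) (h : T -> R) (C c : R) :
  measurable_fun setT h -> (forall x, 0 <= h x) -> 0 < C -> 0 < c ->
  (forall t, 0 < t -> (P [set x | (t <= h x)%R] <= (C * expR (- c * t ^+ 2))%:E)%E) ->
  (\int[P]_x (h x)%:E <= ((1 + C) / Num.sqrt c)%:E)%E.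
Proof.
move=> mh h0 C0 c0 tail.
(* At this scale [c * (s * n) ^ 2 = n ^ 2]. The function [h] is dominated by [s] times the number of
   [n] with [s * n <= h x], so its mean is at most the sum of the [s * P (A n)]. *)
pose s := (Num.sqrt c)^-1.
have s0 : 0 < s by rewrite invr_gt0 sqrtr_gt0.
pose A n := [set x | s * n%:R <= h x].
have mA n : measurable (A n) by exact: measurable_superlevel.
have intE n : (\int[P]_x (s * \1_(A n) x)%:E = s%:E * P (A n))%E.
  under eq_integral do rewrite EFinM.
  rewrite ge0_integralZl//; last 2 first.
  - by apply/measurable_EFinP; exact: measurable_indic.
  - by rewrite lee_fin ltW.
  by rewrite integral_indic// setIT.
apply: (@le_trans _ _ (\int[P]_x \sum_(0 <= n <oo) (s * \1_(A n) x)%:E)%E).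
  apply: ge0_le_integral => //.
  - by move=> x _; rewrite lee_fin.
  - exact/measurable_EFinP.
  - apply: ge0_emeasurable_sum => [n x _ _|n _]; first by rewrite lee_fin mulr_ge0// ltW.
    by apply/measurable_EFinP/measurable_funM => //; exact: measurable_indic.
  (* The indices from 0 to [k] all count, which gives [s * (k + 1)], more than [h x]. *)
  move=> x _; pose k := Num.truncn (h x / s).
  have hk : h x / s < k.+1%:R by exact: truncnS_gt.
  apply: (@le_trans _ _ (\sum_(0 <= n < k.+1) (s * \1_(A n) x)%:E)%E); last first.
    by apply: nneseries_lim_ge => n _ _; rewrite lee_fin mulr_ge0// ltW.
  rewrite sumEFin lee_fin (eq_big_nat _ _ (F2 := fun=> s)); last first.
    move=> n /andP[_ nk]; rewrite indicE mem_set ?mulr1//= /A/=.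
    rewrite mulrC -ler_pdivlMr//; apply: (@le_trans _ _ k%:R); first by rewrite ler_nat.
    by rewrite truncn_le// divr_ge0// ltW.
  rewrite sumr_const_nat subn0 -mulr_natr.
  by move: hk; rewrite ltr_pdivrMr// mulrC => /ltW.
rewrite integral_nneseries//; last 2 first.
- by move=> n; apply/measurable_EFinP/measurable_funM => //; exact: measurable_indic.
- by move=> n x _; rewrite lee_fin mulr_ge0// ltW.
under eq_eseriesr do rewrite intE.
apply: lime_le.
  by apply: is_cvg_nneseries => n _ _; rewrite mule_ge0// lee_fin ltW.
apply: nearW => N /=.
have step n : (s%:E * P (A n.+1) <= (s * C * 2^-1 ^+ n.+1)%:E)%E.
  rewrite -mulrA EFinM lee_wpmul2l ?lee_fin ?(ltW s0)//.
  have := tail (s * n.+1%:R); rewrite mulr_gt0// => /(_ isT) /le_trans; apply.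
  rewrite lee_fin ler_pM2l//; apply: le_trans (expRN_le_half_exp R n.+1).
  by rewrite ler_expR exprMn mulrA mulNr exprVn sqr_sqrtr ?(ltW c0)// mulNr divff ?gt_eqF// mul1r.
(* The term [n = 0] is bounded by [s] alone, since the tail is assumed only for [t > 0]; the others
   form a geometric sum, whose closed form makes the induction go through. *)
case: N => [|N]; first by rewrite big_geq// lee_fin divr_ge0 ?sqrtr_ge0// addr_ge0// ltW.
suff : (\sum_(0 <= n < N.+1) s%:E * P (A n) <= (s * (1 + C * (1 - 2^-1 ^+ N)))%:E)%E.
  by move=> /le_trans; apply; rewrite lee_fin mulrC ler_pM2r// lerD2l ler_piMr ?(ltW C0)//.
elim: N => [|N IH].
  rewrite big_nat1 expr0 subrr mulr0 addr0 EFinM lee_wpmul2l ?lee_fin ?(ltW s0)//.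
  exact: probability_le1.
rewrite big_nat_recr//=; apply: le_trans (leeD IH (step N)) _.
by rewrite -EFinD lee_fin exprS le_eqVlt; apply/orP; left; apply/eqP; field.
Qed.

Lemma deviation_from_mean d (T : measurableType d) (R : realType)
    (P : probability T R) (f : T -> R) (m C c : R) :
  measurable_fun setT f -> 0 < C -> 0 < c ->
  (forall t, 0 < t ->
    (P [set x | (t <= `|f x - m|)%R] <= (C * expR (- c * t ^+ 2))%:E)%E) ->
  forall r, 0 < r ->
    (P [set x | r%:E <= `|(f x)%:E - \int[P]_y (f y)%:E|] <=
       ((C + expR ((1 + C) ^+ 2)) * expR (- (c / 4) * r ^+ 2))%:E)%E.
Proof.
move=> mf C0 c0 tail r r0.
pose a := (1 + C) / Num.sqrt c.
have a0 : 0 < a by rewrite divr_gt0 ?sqrtr_gt0// addr_gt0.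
have mh : measurable_fun setT (fun x => `|f x - m|).
  by apply: measurableT_comp => //; exact: measurable_funB.
have Eh : (\int[P]_x (`|f x - m|)%:E <= a%:E)%E.
  apply: expectation_gaussian_tail => //.
have ih : P.-integrable setT (fun x => (f x - m)%:E).
  apply/integrableP; split; first exact/measurable_EFinP/measurable_funB.
  by apply: le_lt_trans Eh _; exact: ltry.
have im : P.-integrable setT (fun=> m%:E) by exact: finite_measure_integrable_cst.
have iE : (\int[P]_x (f x)%:E = \int[P]_x (f x - m)%:E + m%:E)%E.
  transitivity (\int[P]_x ((f x - m)%:E + m%:E))%E.
    by apply: eq_integral => x _; rewrite -EFinD subrK.
  by rewrite integralD// integral_cst//= probability_setT mule1.
have : (`|\int[P]_x (f x - m)%:E| <= a%:E)%E.
  apply: le_trans Eh; apply: le_abse_integral => //.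
  exact/measurable_EFinP/measurable_funB.
(* The bound by [a] excludes infinite values, so the mean of [f] is [e + m] with [e] real and
   [|e| <= a]. *)
move: iE; case: (\int[P]_x (f x - m)%:E)%E => [e -> | _ | _] //; rewrite lee_fin => ea.
have mS : measurable [set x | (r%:E <= `|(f x)%:E - (e%:E + m%:E)|)%E].
  rewrite (_ : [set _ | _] = [set x | r <= `|f x - (e + m)|]).
    by apply: measurable_superlevel; apply: measurableT_comp => //; exact: measurable_funB.
  by apply/seteqP; split.
have [ra|ar] := ltP r (2 * a).
  apply: le_trans (probability_le1 _ mS) _; rewrite lee_fin mulrDl.
  rewrite (le_trans (y := expR ((1 + C) ^+ 2) * expR (- (c / 4) * r ^+ 2)))//; last first.
    by rewrite lerDr mulr_ge0 ?expR_ge0// ltW.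
  rewrite -expRD -[leLHS]expR0 ler_expR mulNr subr_ge0.
  have -> : (1 + C) ^+ 2 = c / 4 * (2 * a) ^+ 2.
    by rewrite /a exprMn expr_div_n sqr_sqrtr ?(ltW c0)//; field; rewrite gt_eqF.
  by rewrite ler_pM2l ?divr_gt0// lerXn2r// ?nnegrE ?ltW// mulr_gt0.
(* Here [|e| <= a <= r / 2], so a deviation [r] from the mean forces a deviation [r / 2] from
   [m]. *)
apply: (@le_trans _ _ (P [set x | r / 2 <= `|f x - m|])).
  apply: le_measure; rewrite ?inE//; first exact: measurable_superlevel.
  move=> x /=; rewrite lee_fin => h.
  have : `|f x - (e + m)| <= `|f x - m| + `|e|.
    by rewrite (_ : f x - (e + m) = (f x - m) - e) ?ler_normB//; ring.
  lra.
apply: le_trans (tail _ _) _; first by rewrite divr_gt0.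
rewrite lee_fin mulrDl.
have -> : - c * (r / 2) ^+ 2 = - (c / 4) * r ^+ 2 by field.
by rewrite lerDl mulr_ge0 ?expR_ge0.
Qed.

(* With mean [E], the set [A] lies in [{|g - E| >= E}], whence
   [1/2 <= K exp (- k E^2)]; this replaces an explicit bound on [E]. *)
Lemma tail_of_deviation_vanishing d (T : measurableType d) (R : realType)
    (P : probability T R) (A : set T) (g : T -> R) (K k : R) :
  measurable A -> ((2^-1)%:E <= P A)%E ->
  measurable_fun setT g -> (forall x, 0 <= g x) -> (forall x, A x -> g x = 0) ->
  0 < K -> 0 < k ->
  (forall r, 0 < r -> (P [set x | r%:E <= `|(g x)%:E - \int[P]_y (g y)%:E|] <=
     (K * expR (- k * r ^+ 2))%:E)%E) ->
  forall r, 0 < r ->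
    (P [set x | (r <= g x)%R] <= (2 * K * expR (- (k / 4) * r ^+ 2))%:E)%E.
Proof.
move=> mA A2 mg g0 gA K0 k0 dev r r0.
have lek : expR (- k * r ^+ 2) <= expR (- (k / 4) * r ^+ 2).
  by rewrite ler_expR ler_pM2r ?exprn_gt0//; lra.
have : (0 <= \int[P]_y (g y)%:E)%E by apply: integral_ge0 => x _; rewrite lee_fin.
case: (\int[P]_y (g y)%:E)%E dev => [E| |//] dev; last first.
  (* With an infinite mean the deviation set is the whole space, so the hypothesis itself says that
     its right-hand side is at least 1. *)
  move=> _; have := dev _ r0; rewrite (_ : [set _ | _] = setT); last first.
    by apply/seteqP; split => // x _ /=; rewrite leey.
  rewrite probability_setT lee_fin => h.
  apply: le_trans (probability_le1 _ (measurable_superlevel r mg)) _; rewrite lee_fin.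
  apply: (le_trans h); apply: ler_pM => //; rewrite ?expR_ge0 ?(ltW K0)//; lra.
rewrite lee_fin => E0.
have mS t : measurable [set x | (t%:E <= `|(g x)%:E - E%:E|)%E].
  rewrite (_ : [set _ | _] = [set x | t <= `|g x - E|]).
    by apply: measurable_superlevel; apply: measurableT_comp => //; exact: measurable_funB.
  by apply/seteqP; split.
have [rE|Er] := ltP r (2 * E).
  have E_gt0 : 0 < E by lra.
  have : ((2^-1)%:E <= (K * expR (- k * E ^+ 2))%:E)%E.
    apply: (le_trans A2); apply: le_trans (dev _ E_gt0).
    apply: le_measure; rewrite ?inE// => x Ax /=.
    by rewrite gA// lee_fin sub0r normrN ger0_norm.
  rewrite lee_fin => h.
  apply: le_trans (probability_le1 _ (measurable_superlevel r mg)) _; rewrite lee_fin.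
  apply: (@le_trans _ _ (2 * K * expR (- k * E ^+ 2))); first lra.
  rewrite ler_pM2l ?mulr_gt0// ler_expR.
  have -> : - k * E ^+ 2 = - (k / 4) * (2 * E) ^+ 2 by field.
  by rewrite !mulNr lerN2 ler_pM2l ?divr_gt0// lerXn2r// ?nnegrE ?ltW// mulr_gt0.
apply: (@le_trans _ _ (P [set x | ((r / 2)%:E <= `|(g x)%:E - E%:E|)%E])).
  apply: le_measure; rewrite ?inE//; first exact: measurable_superlevel.
  move=> x /= rg; rewrite lee_fin; apply: le_trans (ler_norm _); lra.
apply: le_trans (dev _ _) _; first by rewrite divr_gt0.
rewrite lee_fin (_ : - k * (r / 2) ^+ 2 = - (k / 4) * r ^+ 2); last by field.
by rewrite ler_wpM2r ?expR_ge0//; lra.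
Qed.

(** * The distance from a set in an irreversible metric *)

Section distance_from_set.
Variables (R : realType) (X : Type) (d : X -> X -> R).
Hypothesis d0 : forall x y, 0 <= d x y.
Hypothesis tri : forall x y z, d x z <= d x y + d y z.

(** The infimum is real, with the junk value 0 for empty [A], whence the hypothesis [A0] below. The
    distance to [A] is obtained by reversing the arguments of [d]. *)
Definition dist_from (A : set X) (x : X) : R := inf [set d z x | z in A].

Variable A : set X.
Hypothesis A0 : A !=set0.

Let has_inf_dist x : has_inf [set d z x | z in A].
Proof.
split; first by case: A0 => z Az; exists (d z x), z.
by exists 0 => _ [z _ <-].
Qed.

Lemma dist_from_ge0 x : 0 <= dist_from A x.
Proof. by apply: lb_le_inf => [|_ [z _ <-]//]; case: (has_inf_dist x). Qed.

Lemma dist_from_le z x : A z -> dist_from A x <= d z x.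
Proof. by move=> Az; apply: ge_inf; [case: (has_inf_dist x) | exists z]. Qed.

Lemma dist_from_triangle x y : dist_from A y <= dist_from A x + d x y.
Proof.
rewrite -lerBlDr; apply: lb_le_inf => [|_ [z Az <-]]; first by case: (has_inf_dist x).
by rewrite lerBlDr (le_trans (dist_from_le y Az)).
Qed.

(** For nonempty [A], the extended and the real infimum are each below [r] exactly when some point
    of [A] is at distance below [r]. *)
Lemma setC_fwd_nbhd r : ~` fwd_nbhd d A r = [set x | r <= dist_from A x].
Proof.
apply/seteqP; split => x; rewrite /fwd_nbhd/=.
  move=> h; rewrite leNgt; apply/negP => /(inf_lt (has_inf_dist x).1) [_ [z Az <-] dr].
  by apply: h; apply/ereal_inf_ltP; exists (d z x)%:E; [exists z | rewrite lte_fin].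
move=> rx /ereal_inf_ltP [_ [z Az <-]]; rewrite lte_fin ltNge => /negP; apply.
exact: le_trans rx (dist_from_le x Az).
Qed.

End distance_from_set.

(** * From concentration to deviation *)

Lemma concentration_bound_setC (R : realType) (X : ptopologicalType)
    (d : X -> X -> R) (mu : probability (borelType X) R) (C c r : R)
    (A : set (borelType X)) :
  borel_compatible d -> concentration_bound d mu C c -> 0 < r ->
  measurable A -> ((2^-1)%:E <= mu A)%E ->
  (mu (~` fwd_nbhd d A r) <= (C * expR (- c * r ^+ 2))%:E)%E /\
  (mu (~` bwd_nbhd d A r) <= (C * expR (- c * r ^+ 2))%:E)%E.
Proof.
move=> [mN _] cb r0 mA A2.
have [mF mB] := mN A r mA r0.
have le : (1 - Order.min (mu (fwd_nbhd d A r)) (mu (bwd_nbhd d A r)) <=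
  (C * expR (- c * r ^+ 2))%:E)%E.
  by apply: le_trans (cb r r0); apply: ereal_sup_ubound; exists A.
(* One minus the minimum is the larger of the measures of the two complements. *)
rewrite !probability_setC//; split; apply: le_trans le; apply: leeB => //.
  by rewrite ge_min lexx.
by rewrite ge_min lexx orbT.
Qed.

Lemma concentration_deviation (R : realType) (X : ptopologicalType)
    (d : X -> X -> R) (mu : probability (borelType X) R) (C c : R) :
  borel_compatible d -> 0 < C -> 0 < c -> concentration_bound d mu C c ->
  deviation_bound d mu (2 * C + expR ((1 + 2 * C) ^+ 2)) (c / 4).
Proof.
move=> bc C0 c0 cb f Lf.
have mf : measurable_fun [set: borelType X] f by case: bc => _ /(_ 1 f); apply.
pose F : {RV mu >-> R} := mfun_Sub (mem_set mf).
have [m [ml mr]] := median_exists F.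
apply: (@deviation_from_mean _ _ _ mu f m) => //; first by rewrite mulr_gt0.
move=> t t0.
have mI (i : interval R) : measurable (f @^-1` [set` i] : set (borelType X)).
  exact: (measurable_funPTI F).
have [up _] := concentration_bound_setC bc cb t0 (mI _) ml.
have [_ down] := concentration_bound_setC bc cb t0 (mI _) mr.
have [[mF _] [_ mB]] := (bc.1 _ _ (mI `]-oo, m]) t0, bc.1 _ _ (mI `[m, +oo[) t0).
(* The constant [2 * C] pays for two one-sided tails, one for each complement. *)
rewrite mulr2n mulrDl mul1r mulrDl EFinD; apply: le_trans (leeD up down).
pose U := ~` fwd_nbhd d (f @^-1` `]-oo, m]) t : set (borelType X).
pose V := ~` bwd_nbhd d (f @^-1` `[m, +oo[) t : set (borelType X).
have mU : measurable U by exact: measurableC.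
have mV : measurable V by exact: measurableC.
apply: (@le_trans _ _ (mu (U `|` V))); last exact: measureU2.
apply: le_measure; rewrite ?inE; first last.
(* A point in both neighborhoods has some [z] with [f z <= m] and [d z x < t], so [f x < m + t], and
   some [y] with [f y >= m] and [d x y < t], so [f x > m - t]. *)
- move=> x /= ; apply: contraPP => /not_orP[/contrapT Ux /contrapT Vx].
  apply/negP; rewrite -ltNge.
  move: Ux => /ereal_inf_ltP [_ [z + <-]]; rewrite /= in_itv/= lte_fin => zm zt.
  move: Vx => /ereal_inf_ltP [_ [y + <-]]; rewrite /= in_itv/= andbT lte_fin => my yt.
  have := Lf z x; have := Lf x y; rewrite !mul1r => h1 h2.
  by rewrite ltr_norml; apply/andP; split; lra.
- exact: measurableU.
- by apply: measurable_superlevel; apply: measurableT_comp => //; exact: measurable_funB.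
Qed.

(** * From deviation to concentration *)

Lemma deviation_set_opp d (T : measurableType d) (R : realType)
    (mu : probability T R) (g : T -> R) :
  (forall x, 0 <= g x) ->
  forall r, [set x | (r%:E <= `|(- g x)%:E - \int[mu]_y (- g y)%:E|)%E] =
            [set x | (r%:E <= `|(g x)%:E - \int[mu]_y (g y)%:E|)%E].
Proof.
move=> g0 r; under eq_integral do rewrite EFinN.
(* Nonnegativity lets the sign leave the integral even when it is infinite. *)
rewrite integral_ge0N => [|x _]; last by rewrite lee_fin.
by apply/funext => x /=; rewrite EFinN -oppeD ?abseN// fin_num_adde_defr.
Qed.

Lemma deviation_concentration (R : realType) (X : ptopologicalType)
    (d : X -> X -> R) (mu : probability (borelType X) R) (K k : R) :
  irreversible_metric d -> borel_compatible d -> 0 < K -> 0 < k ->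
  deviation_bound d mu K k -> concentration_bound d mu (2 * K) (k / 4).
Proof.
move=> [d0 dE tri] bc K0 k0 dev r r0.
have dxx x : d x x = 0 by apply/dE.
apply/ereal_supP => _ [A [mA A2] <-].
have A0 : A !=set0.
  by apply/set0P/negP => /eqP E; move: A2; rewrite E measure0 lee_fin; lra.
have [mF mB] := bc.1 A r mA r0.
have mlip (f : X -> R) : irr_lipschitz d 1 f -> measurable_fun [set: borelType X] f.
  by apply: bc.2.
(* Backward neighborhoods for [d] are forward ones for [d'], so a single distance construction
   serves both sides. *)
pose d' x y := d y x.
have d'0 x y : 0 <= d' x y by exact: d0.
have tri' x y z : d' x z <= d' x y + d' y z by rewrite addrC; exact: tri.
have van (e : X -> X -> R) (e0 : forall x y, 0 <= e x y) (exx : forall x, e x x = 0)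
    x : A x -> dist_from e A x = 0.
  move=> Ax; apply/eqP; rewrite eq_le dist_from_ge0// andbT.
  by rewrite (le_trans (dist_from_le e0 A0 x Ax))// exx.
have fwd_tail : (mu (~` fwd_nbhd d A r) <=
    (2 * K * expR (- (k / 4) * r ^+ 2))%:E)%E.
  have L : irr_lipschitz d 1 (dist_from d A).
    by move=> x z; rewrite mul1r; have := dist_from_triangle d0 tri A0 x z; lra.
  rewrite setC_fwd_nbhd//; apply: (tail_of_deviation_vanishing mA A2) => //.
  - exact: mlip.
  - by move=> x; exact: dist_from_ge0.
  - exact: van.
  - exact: dev.
have bwd_tail : (mu (~` bwd_nbhd d A r) <=
    (2 * K * expR (- (k / 4) * r ^+ 2))%:E)%E.
  have L : irr_lipschitz d 1 (fun x => - dist_from d' A x).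
    by move=> x z; rewrite mul1r; have := dist_from_triangle d'0 tri' A0 z x; rewrite /d'; lra.
  have g0 x : 0 <= dist_from d' A x by exact: dist_from_ge0.
  rewrite -[bwd_nbhd d A r]/(fwd_nbhd d' A r) setC_fwd_nbhd//.
  apply: (tail_of_deviation_vanishing mA A2) => //.
  (* Minus the distance to [A] is the function shown 1-Lipschitz for [d], so measurability passes
     through a double negation. *)
  - rewrite (_ : dist_from d' A = (fun x => - - dist_from d' A x)).
      exact: measurable_funN (mlip _ L).
    by apply/funext => x; rewrite opprK.
  - exact: van.
  - by move=> s s0; rewrite -deviation_set_opp//; exact: dev.
by rewrite /Order.min; case: ifP => _; rewrite -probability_setC.
Qed.

Theorem theorem3p3 (R : realType) :
  exists C' c' : R -> R,
    [/\ forall C : R, 0 < C -> 0 < C' C,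
        forall c : R, 0 < c -> 0 < c' c &
        forall (X : ptopologicalType) (d : X -> X -> R)
               (mu : probability (borelType X) R),
          irreversible_metric d -> borel_compatible d ->
          (normal_concentration d mu <->
             exists K k : R, [/\ 0 < K, 0 < k & deviation_bound d mu K k]) /\
          (forall C c : R, 0 < C -> 0 < c ->
             concentration_bound d mu C c ->
             deviation_bound d mu (C' C) (c' c))].
Proof.
(* This is the constant of [deviation_from_mean] at the tail factor [2 * C]. *)
pose C' (C : R) := 2 * C + expR ((1 + 2 * C) ^+ 2).
have C'_gt0 C : 0 < C -> 0 < C' C by move=> C0; rewrite addr_gt0 ?mulr_gt0 ?expR_gt0.
exists C', (fun c => c / 4); split => // [c c0|X d mu dm bc]; first by rewrite divr_gt0.
split; last by move=> C c C0 c0; exact: concentration_deviation.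
split=> [[C [c [C0 c0 cb]]]|[K [k [K0 k0 dev]]]].
  exists (C' C), (c / 4); split; [exact: C'_gt0|by rewrite divr_gt0|].
  exact: concentration_deviation.
exists (2 * K), (k / 4); split; [by rewrite mulr_gt0|by rewrite divr_gt0|].
exact: deviation_concentration.
Qed.
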